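(* Let $m\ge 1$ be an integer. For every integer $N\ge 0$, the $2m$-fold sum $$\begin{aligned}\mathcal{X}_N^{(m)}(a,t,q):=(atq)_N\sum_{\substack{r_1,\ldots,r_m\ge 0\\ s_1,\ldots,s_m\ge 0}}&\frac{a^{\sum_{i=1}^m s_i}\,t^{\sum_{i=1}^m(2r_i-s_i)}\,q^{\sum_{i=1}^m(r_i^2-r_is_i+s_i^2)}\,(aq)_{r_1}}{(q)_{N-r_m}(q)_{r_m-r_{m-1}}\cdots(q)_{r_2-r_1}(q)_{r_1}(tq)_{r_1}(atq)_{r_1}(aq)_{s_1}}\\ &\times{r_m-s_{m-1}\brack r_m-s_m}{r_{m-1}-s_{m-2}\brack r_{m-1}-s_{m-1}}\cdots{r_2-s_1\brack r_2-s_2}{r_1\brack r_1-s_1}\end{aligned}$$ is independent of $a$. In particular, $$\mathcal{X}_N^{(m)}(a,t,q)=\sum_{n_1,\ldots,n_m\ge 0}\frac{t^{\sum_{i=1}^m 2n_i}\,q^{\sum_{i=1}^m n_i^2}}{(q)_{N-n_m}(q)_{n_m-n_{m-1}}\cdots(q)_{n_2-n_1}(q)_{n_1}(tq)_{n_1}}.$$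
   Context: Notation: $(A)_N=(A;q)_N:=\prod_{j=0}^{N-1}(1-Aq^j)$, with $1/(q)_k:=0$ for $k<0$. The $q$-binomial coefficient is ${N\brack M}:=\frac{(q)_N}{(q)_M(q)_{N-M}}$ if $0\le M\le N$ and $0$ otherwise. For $m=1$ the product of $q$-binomials is just ${r_1\brack r_1-s_1}$, and the denominator factors $(q)_{N-r_m}\cdots(q)_{r_2-r_1}$ reduce to $(q)_{N-r_1}$. All sums are finite; $a,t,q$ are indeterminates, and the identity is one of rational functions in $a,t,q$. *)

(* Defs.v *)
From HB Require Import structures.
From mathcomp Require Import all_boot all_order all_algebra.
From mathcomp Require Import boolp classical_sets cardinality fsbigop.

Set Implicit Arguments.
Unset Strict Implicit.
Unset Printing Implicit Defensive.

Import Order.TTheory GRing.Theory Num.Theory.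
Local Open Scope ring_scope.

(* F(x), together with its indeterminate and the inclusion F -> F(x). *)
Definition ratfun (F : fieldType) : fieldType := {fraction {poly F}}.
Definition rvar (F : fieldType) : ratfun F := FracField.tofrac 'X.
Definition rconst (F : fieldType) (c : F) : ratfun F := FracField.tofrac c%:P.

(* The field k(a,t,q) of rational functions, built as k(q)(t)(a), so that the
   elements not involving a are the constants of the outermost extension. *)
Definition ratfun_tq (k : fieldType) : fieldType := ratfun (ratfun k).
Definition ratfun_atq (k : fieldType) : fieldType := ratfun (ratfun_tq k).

Definition var_a (k : fieldType) : ratfun_atq k := rvar (ratfun_tq k).
Definition var_t (k : fieldType) : ratfun_atq k := rconst (rvar (ratfun k)).
Definition var_q (k : fieldType) : ratfun_atq k := rconst (rconst (rvar k)).

Definition independent_of_a (k : fieldType) (x : ratfun_atq k) : Prop :=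
  exists c : ratfun_tq k, x = rconst c.

Section Sums.
Variable F : fieldType.
Implicit Types (A a t q : F) (m N : nat) (r s n : seq nat).

(* (A; q)_N *)
Definition qpoch A q N : F := \prod_(0 <= j < N) (1 - A * q ^+ j).

(* 1 / (q)_k for an integer k, zero when k < 0 *)
Definition inv_qfact q (k : int) : F :=
  if k is Posz n then (qpoch q q n)^-1 else 0.

Definition qbinom q (n k : int) : F :=
  if (0 <= k) && (k <= n)
  then qpoch q q `|n|%N / (qpoch q q `|k|%N * qpoch q q `|n - k|%N)
  else 0.

(* The i-th entry of r = [:: r_1; ...; r_m] counted from 1, with r_0 = 0, as an
   integer: differences of indices may be negative. *)
Definition ix r (i : nat) : int := (nth 0%N (0%N :: r) i)%:Z.

(* 1 / ((q)_{N - r_m} (q)_{r_m - r_{m-1}} ... (q)_{r_2 - r_1} (q)_{r_1}) *)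
Definition inv_qchain q m N r : F :=
  inv_qfact q (N%:Z - ix r m)
  * \prod_(1 <= i < m.+1) inv_qfact q (ix r i - ix r i.-1).

Definition Xterm m N a t q r s : F :=
  a ^ (\sum_(1 <= i < m.+1) ix s i)
  * t ^ (\sum_(1 <= i < m.+1) (2 * ix r i - ix s i))
  * q ^ (\sum_(1 <= i < m.+1) (ix r i ^+ 2 - ix r i * ix s i + ix s i ^+ 2))
  * qpoch (a * q) q `|ix r 1|%N
  * inv_qchain q m N r
  / (qpoch (t * q) q `|ix r 1|%N * qpoch (a * t * q) q `|ix r 1|%N
     * qpoch (a * q) q `|ix s 1|%N)
  * \prod_(1 <= i < m.+1) qbinom q (ix r i - ix s i.-1) (ix r i - ix s i).

(* The sums below, over all tuples of naturals, are sums of finitely supported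
   families (the [\in] big operator returns 0 on infinite support): see
   [Xterm_support] and [Yterm_support]. *)
Definition Xsum m N a t q : F :=
  qpoch (a * t * q) q N
  * \sum_(rs \in [set: m.-tuple nat * m.-tuple nat])
      Xterm m N a t q rs.1 rs.2.

Definition Yterm m N t q n : F :=
  t ^ (\sum_(1 <= i < m.+1) 2 * ix n i)
  * q ^ (\sum_(1 <= i < m.+1) ix n i ^+ 2)
  * inv_qchain q m N n
  / qpoch (t * q) q `|ix n 1|%N.

Definition Ysum m N t q : F :=
  \sum_(n \in [set: m.-tuple nat]) Yterm m N t q n.

Lemma inv_qchain_neq0 q m N r :
  inv_qchain q m N r != 0 -> forall i, (i <= m)%N -> ix r i <= N%:Z.
Proof.
rewrite /inv_qchain mulf_eq0 negb_or => /andP[hm hp].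
have step k : inv_qfact q k != 0 -> 0 <= k.
  by case: k => // k; rewrite eqxx.
have hi i : (i < m)%N -> ix r i <= ix r i.+1.
  move=> im; rewrite -subr_ge0; apply: step.
  move: hp; rewrite prodf_seq_neq0 => /allP/(_ i.+1).
  by rewrite mem_index_iota /= !ltnS im; apply.
have hN : ix r m <= N%:Z by rewrite -subr_ge0; apply: step.
move=> i; have [d] := ubnP (m - i)%N; elim: d i => // d IH i.
rewrite ltnS => hd; rewrite leq_eqVlt => /predU1P[->//|im].
apply: le_trans (hi _ im) _; apply: IH => //.
by rewrite subnS; apply: leq_trans hd; rewrite prednK // subn_gt0.
Qed.

Lemma Xterm_support m N a t q r s :
  Xterm m N a t q r s != 0 ->
  forall i, (1 <= i <= m)%N -> ix s i <= ix r i <= N%:Z.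
Proof.
move=> h i hi.
have hc : inv_qchain q m N r != 0.
  by apply: contraNneq h => h0; rewrite /Xterm h0 mulr0 !mul0r.
move: h; rewrite mulf_eq0 negb_or => /andP[_ hb].
have /andP[i0 im] := hi.
rewrite (inv_qchain_neq0 hc im) andbT.
move: hb; rewrite prodf_seq_neq0 => /allP/(_ i).
rewrite mem_index_iota ltnS hi /= => /(_ isT).
by rewrite /qbinom subr_ge0; case: (ix s i <= ix r i) => //=; rewrite eqxx.
Qed.

Lemma Yterm_support m N t q n :
  Yterm m N t q n != 0 -> forall i, (i <= m)%N -> ix n i <= N%:Z.
Proof.
move=> h; apply: (@inv_qchain_neq0 q).
by apply: contraNneq h => h0; rewrite /Yterm h0 mulr0 mul0r.
Qed.

End Sums.

(* Main.v *)
Require Import Defs.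
From mathcomp Require Import all_boot all_order all_algebra.
From mathcomp Require Import classical_sets fsbigop ring.

(** Read the pairs [(r_i, s_i)] as the states of a path: up to factors in the
first pair and in [N], the summand is a product over consecutive pairs, so that
the [2m]-fold sum is obtained from one function [h_1(r, s)] (called [seed]) by
applying [m] times a linear operator [T] ([transfer]) on functions of two
indices and reading the result on the diagonal: up to a factor [(q)_N] it is
[(T^m h_1)(N, N)] ([XsumE]). In the same way the [m]-fold sum on the right is
obtained from [1 / ((q)_n (t q)_n)] by applying [m] times the operator
  [U y (N) = sum_r t^(2r) q^(r^2) y(r) / (q)_(N-r)].
As [h_1(r, r) = 1 / (t q)_r], the theorem follows if [h(r, r) / (q)_r] is
transformed by [U] whenever [h] is transformed by [T].

This is not true of every [h], but it is true of the solutions of a four-term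
relation ([four_term]) that [h_1] satisfies.  Two facts are needed.

- [T] preserves the relation ([transfer_four_term]).  The defect of [T h] at one
  place is a sum of multiples [C(r, s)] of the defects of [h].  The [C(r, s)] are
  hypergeometric like the kernel of [T], so the claim is a summation by
  parts that comes down to one identity between rational functions of [q^R],
  [q^S], [q^r] and [q^s] ([tker_telescope]).

- For a solution [h] of the relation, the diagonal of [T h] depends only on the
  diagonal of [h] ([transfer_diag]).  In row [R] of [T h], consider the
  [q]-differences starting from the diagonal entry: the difference of order 0 is
  the diagonal entry itself, and in the one of order [R] the
  orthogonality relation [sum_d (-1)^d q^(d(d-1)/2) [n; d] = 0] for [n > 0]
  leaves a single term, a multiple of [h(R, R)].  The four-term relation for
  [T h] becomes a three-term recursion for the differences, which determines all of
  them from those of top order, and which has an explicit solution; in order 0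
  that solution is [U].

In this argument [a] enters the relation but not the operator [U], and this is
why it disappears from the sum. *)

Set Implicit Arguments.
Unset Strict Implicit.
Unset Printing Implicit Defensive.

Import Order.TTheory GRing.Theory Num.Theory.
Local Open Scope ring_scope.

(** * Inverse q-factorials and q-binomial orthogonality *)

Section QSeries.
Variables (F : fieldType) (q : F).
Hypothesis q_neq0 : q != 0.
Hypothesis qX_neq1 : forall n : nat, 1 - q ^+ n.+1 != 0.

Lemma qpoch0 A : qpoch A q 0 = 1.
Proof. by rewrite /qpoch big_geq. Qed.

Lemma qpochS A n : qpoch A q n.+1 = qpoch A q n * (1 - A * q ^+ n).
Proof. by rewrite /qpoch big_nat_recr. Qed.

Lemma qpoch_neq0 A n : (forall j, 1 - A * q ^+ j != 0) -> qpoch A q n != 0.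
Proof.
move=> hA; elim: n => [|n IH]; first by rewrite qpoch0 oner_neq0.
by rewrite qpochS mulf_neq0.
Qed.

Lemma qfact_neq0 n : qpoch q q n != 0.
Proof. by apply: qpoch_neq0 => j; rewrite -exprS. Qed.

Lemma qfactSB n s : (s <= n)%N ->
  qpoch q q (n.+1 - s) = qpoch q q (n - s) * (1 - q ^+ n.+1 / q ^+ s).
Proof. by move=> sn; rewrite subSn // qpochS -exprS -subSn // expfB // leqW. Qed.

(** The difference is taken in the integers, so that the value is 0 for
[m < n]: the recurrences [ifactS] and [ifact_pred] then hold without side
conditions, and sums over [m] and [n] need no boundary terms. *)
Definition ifact (m n : nat) : F := inv_qfact q (m%:Z - n%:Z).

Lemma ifact0r n : ifact n 0 = (qpoch q q n)^-1.
Proof. by rewrite /ifact subr0. Qed.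

Lemma ifactSS m n : ifact m.+1 n.+1 = ifact m n.
Proof. by rewrite /ifact !intS opprD addrACA subrr add0r. Qed.

Lemma ifact_add d n : ifact (n + d) n = (qpoch q q d)^-1.
Proof. by rewrite /ifact PoszD addrC addKr. Qed.

Lemma ifactE m n : (n <= m)%N -> ifact m n = (qpoch q q (m - n))^-1.
Proof. by move=> nm; rewrite -{1}(subnKC nm) ifact_add. Qed.

Lemma ifactnn n : ifact n n = 1.
Proof. by rewrite -{1}[n]addn0 ifact_add qpoch0 invr1. Qed.

Lemma ifact_small m n : (m < n)%N -> ifact m n = 0.
Proof.
move=> mn; rewrite /ifact -opprB subzn ?(ltnW mn) //.
by rewrite -(prednK (_ : 0 < n - m)%N) ?subn_gt0.
Qed.

Lemma ifactS m n : ifact m n.+1 = (1 - q ^+ m / q ^+ n) * ifact m n.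
Proof.
case: (ltngtP m n) => [mn|nm|->]; last 1 first.
- by rewrite divff ?expf_neq0 // subrr mul0r ifact_small.
- by rewrite !ifact_small ?mulr0 // ltnW.
rewrite -(subnKC nm); move: (m - n.+1)%N => d.
rewrite ifact_add addSnnS ifact_add qpochS exprD -exprS.
by rewrite [q ^+ n * _]mulrC mulfK ?expf_neq0 // invfM mulrCA mulfV ?mulr1.
Qed.

Lemma ifact_pred m n : ifact m n = (1 - q ^+ m.+1 / q ^+ n) * ifact m.+1 n.
Proof. by rewrite -ifactS ifactSS. Qed.

Definition gsign (d : nat) : F := (-1) ^+ d * q ^+ 'C(d, 2).

Lemma gsign0 : gsign 0 = 1.
Proof. by rewrite /gsign bin0n mulr1. Qed.

Lemma gsignS d : gsign d.+1 = - (q ^+ d * gsign d).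
Proof. by rewrite /gsign binS bin1 exprD exprS; ring. Qed.

(** The case [x = 1] of the finite [q]-binomial theorem for [(x; q)_n].  After
multiplication by [1 - q^n] the partial sums have a closed form, which vanishes
as soon as the summation range reaches [n]. *)
Lemma gsign_sum B n : (n <= B)%N ->
  \sum_(d < B.+1) gsign d * ifact d 0 * ifact n d = (n == 0%N)%:R.
Proof.
case: n => [_|n nB].
  rewrite big_ord_recl big1 => [|i _]; last by rewrite (ifact_small (ltn0Sn i)) mulr0.
  by rewrite gsign0 !ifactnn addr0 !mulr1.
apply: (@mulfI _ (1 - q ^+ n.+1)); rewrite ?qX_neq1 // mulr0.
suff -> : forall m,
    (1 - q ^+ n.+1) * \sum_(d < m.+1) gsign d * ifact d 0 * ifact n.+1 d
    = gsign m * q ^+ m * ifact m 0 * ifact n m.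
  by rewrite [ifact n B]ifact_small ?mulr0.
elim=> [|m IH].
  rewrite big_ord_recl big_ord0 addr0 gsign0 expr0 !ifactnn !mul1r.
  by rewrite [in RHS]ifact_pred expr0 divr1.
rewrite big_ord_recr /= mulrDr {}IH ifactSS [ifact n m.+1]ifactS gsignS.
rewrite [ifact m 0]ifact_pred !exprS expr0 divr1.
have := expf_neq0 m q_neq0; move: (q ^+ m) (q ^+ n) (ifact n m) => x y z x0.
by field.
Qed.

End QSeries.

(** * The transfer operator *)

Section FiniteSums.
Variable F : fieldType.

Lemma sum_ord_widen (n m : nat) (f : nat -> F) : (n <= m)%N ->
  (forall i, (n <= i)%N -> f i = 0) -> \sum_(i < n) f i = \sum_(i < m) f i.
Proof.
move=> nm f0; rewrite (big_ord_widen m f nm) [RHS](bigID (fun i : 'I_m => i < n)%N) /=.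
by rewrite [X in _ = _ + X]big1 ?addr0 // => i; rewrite -leqNgt => /f0.
Qed.

Lemma sum_ord_extend (n : nat) (f : nat -> F) : f n = 0 ->
  \sum_(i < n) f i = \sum_(i < n.+1) f i.
Proof. by move=> fn; rewrite big_ord_recr /= fn addr0. Qed.

Lemma sum_ord_shift (n : nat) (f : nat -> F) : f 0%N = 0 -> f n = 0 ->
  \sum_(i < n) f i.+1 = \sum_(i < n) f i.
Proof.
move=> f0 fn; apply/eqP; rewrite -[X in X == _]add0r -{1}f0.
by rewrite -(big_ord_recl n (fun i : 'I_n.+1 => f i)) big_ord_recr /= fn addr0.
Qed.

Lemma sum_ord_split4 (n : nat) (f : 'I_n -> 'I_n -> F) (f1 f2 f3 f4 : nat -> nat -> F) :
  (forall r s, f r s = f1 r s + f2 r s + f3 r s + f4 r s) ->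
  \sum_(r < n) \sum_(s < n) f r s
  = \sum_(r < n) \sum_(s < n) f1 r s + \sum_(r < n) \sum_(s < n) f2 r s
    + \sum_(r < n) \sum_(s < n) f3 r s + \sum_(r < n) \sum_(s < n) f4 r s.
Proof.
move=> E; rewrite -!big_split; apply: eq_bigr => r _.
by rewrite -!big_split; apply: eq_bigr => s _; exact: E.
Qed.

End FiniteSums.

Section Transfer.
Variables (F : fieldType) (q a t : F).
Hypothesis q_neq0 : q != 0.
Hypothesis qX_neq1 : forall n : nat, 1 - q ^+ n.+1 != 0.
Hypothesis a_neq0 : a != 0.
Hypothesis t_neq0 : t != 0.
Hypothesis atqX_neq1 : forall n : nat, 1 - a * t * q * q ^+ n != 0.

Local Notation P := (qpoch q q).
Local Notation W := (qpoch (a * t * q) q).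
Local Notation ifact := (ifact q).

Let W_neq0 r : W r != 0.
Proof. exact: qpoch_neq0. Qed.

Let WS r : W r.+1 = W r * (1 - a * t * q ^+ r.+1).
Proof. by rewrite qpochS exprS mulrA. Qed.

(** The weight [a^s t^(2r-s) q^(r^2-rs+s^2)] of a pair, written with natural
exponents only. *)
Definition wt (r s : nat) : F :=
  (a / t) ^+ s * t ^+ (2 * r) * (q ^+ (r * r) * q ^+ (s * s) / q ^+ (r * s)).

Lemma wtS_l r s : wt r.+1 s = wt r s * (t ^+ 2 * q ^+ r ^+ 2 * q / q ^+ s).
Proof.
rewrite /wt mulnS mulSn !mulSnr !mulnS !exprD -!exprM !exprS expr0.
have := expf_neq0 (r * s) q_neq0; have := expf_neq0 s q_neq0.
rewrite (mulnC r 2) mul2n -addnn !exprD.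
move: (q ^+ (r * s)) (q ^+ s) (q ^+ r) (q ^+ (r * r)) (q ^+ (s * s)) => x y z u v.
by move=> y0 x0; field; rewrite ?q_neq0 ?t_neq0 ?x0 ?y0.
Qed.

Lemma wtS_r r s : wt r s.+1 = wt r s * (a / t * q ^+ s ^+ 2 * q / q ^+ r).
Proof.
rewrite /wt !mulSnr !mulnS !exprD -!exprM !exprS expr0.
have := expf_neq0 (r * s) q_neq0; have := expf_neq0 r q_neq0.
rewrite (mulnC s 2) mul2n -addnn !exprD.
move: (q ^+ (r * s)) (q ^+ s) (q ^+ r) (q ^+ (r * r)) (q ^+ (s * s)) => x y z u v.
by move=> y0 x0; field; rewrite ?q_neq0 ?t_neq0 ?x0 ?y0.
Qed.

(** The factor of the multisum that links a pair [(r, s)] to the next one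
[(R, S)], conjugated by [(a t q)_r (q)_s].  In this
normalization the coefficients of the relation [four_term] are free of these
[q]-shifted factorials. *)
Definition tker (R S r s : nat) : F :=
  W R * P S * P (R - s) * wt r s * ifact R S * ifact R r * ifact S s * ifact s 0
  / W r.

Definition transfer (h : nat -> nat -> F) (R S : nat) : F :=
  \sum_(r < R.+1) \sum_(s < R.+1) tker R S r s * h r s.

(** In the basis of functions
[sum_j (-a)^j q^(j(j+1)/2 + s j) g(r, j) / ((q)_j (q)_(r-s-j))] of [s], the
relation says that [g(r, j) - t q^r g(r, j+1) = g(r-1, j)], which does not
involve [a]. *)
Definition four_term (h : nat -> nat -> F) : Prop :=
  (forall r s, (r < s)%N -> h r s = 0) /\
  forall r s, (s <= r)%N ->
    t * (q ^+ r / q ^+ s) * (h r.+1 s.+1 - (1 - q ^+ r.+1 / q ^+ s) * h r.+1 s)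
    = a * (h r.+1 s.+1 - q ^+ r / q ^+ s * h r s - h r s.+1).

Lemma tker_rgt R S r s : (R < r)%N -> tker R S r s = 0.
Proof. by move=> h; rewrite /tker (ifact_small _ h) !(mulr0, mul0r). Qed.

Lemma tker_sgt R S r s : (S < s)%N -> tker R S r s = 0.
Proof. by move=> h; rewrite /tker (ifact_small _ h) !(mulr0, mul0r). Qed.

Lemma tker_Sgt R S r s : (R < S)%N -> tker R S r s = 0.
Proof. by move=> h; rewrite /tker (ifact_small _ h) !(mulr0, mul0r). Qed.

(** A range that is independent of [R] is needed to combine the values of
[transfer h] in two consecutive rows. *)
Lemma transfer_box B h R S : (R <= B)%N ->
  transfer h R S = \sum_(r < B.+1) \sum_(s < B.+1) tker R S r s * h r s.
Proof.
move=> RB; rewrite /transfer.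
rewrite (@sum_ord_widen F _ B.+1 (fun r => \sum_(s < R.+1) tker R S r s * h r s)) //.
  apply: eq_bigr => r _.
  apply: (@sum_ord_widen F _ B.+1 (fun s => tker R S r s * h r s)) => // s Rs.
  case: (leqP S R) => SR; first by rewrite tker_sgt ?mul0r // (leq_ltn_trans SR).
  by rewrite tker_Sgt ?mul0r.
by move=> r Rr; apply: big1 => s _; rewrite tker_rgt // mul0r.
Qed.

(** * Invariance of the four-term relation *)

Section Telescoping.
Variables (R S : nat).
Hypothesis SR : (S <= R)%N.

(** The multiplier of the relation of [h] at [(r, s)] in the relation of
[transfer h] at [(R, S)].  Its quotient by the kernel [tker R.+1 S r.+1 s] is a
rational function of [q^R], [q^S], [q^r] and [q^s]. *)
Definition cert r s : F :=
  q ^+ R / q ^+ r * wt r.+1 s.+1 * W R * P S * P (R - s) * ifact R S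
  * ifact R r * ifact S s * ifact s 0 / W r.

(* The multiplier moved by one step in r, in s, or in both. *)
Definition cert_r r s : F := if r is r'.+1 then cert r' s else 0.
Definition cert_s r s : F := if s is s'.+1 then cert r s' else 0.
Definition cert_rs r s : F := if r is r'.+1 then cert_s r' s else 0.

(* A common factor of all the kernels and multipliers of tker_telescope: the
   other factors are polynomials in a few powers of q. *)
Let M r s := wt r s * ifact R.+1 S * ifact R.+1 r * ifact S.+1 s * ifact s 0
  * W R * P S * P (R - s) / W r.

(* Once both sides are multiples of M, the powers of q and the other factors can
   be treated as independent variables. *)
Ltac rational_identity r s :=
  rewrite ?ifactSS ?wtS_l ?wtS_r ?exprS;
  have := atqX_neq1 r; have := W_neq0 r;
  have := expf_neq0 r q_neq0; have := expf_neq0 s q_neq0;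
  have := expf_neq0 S q_neq0;
  move: (q ^+ R) (q ^+ S) (q ^+ r) (q ^+ s) (W r) (W R) (wt r s) (P _) (P _)
    (ifact _ _) (ifact _ _) (ifact _ _) (ifact _ _)
    => QR QS Qr Qs Wr WR w P1 P2 i1 i2 i3 i4 QS0 Qs0 Qr0 Wr0 A0;
  field; do ?[apply/andP; split] => //; rewrite ?mulrA.

Let certE r s : cert r s = M r s * (a * t * q * q ^+ R * q ^+ s)
   * (1 - q ^+ R.+1 / q ^+ S) * (1 - q ^+ R.+1 / q ^+ r)
   * (1 - q ^+ S.+1 / q ^+ s).
Proof.
rewrite /cert /M [ifact R S]ifact_pred // [ifact S s]ifact_pred //.
rewrite [ifact R r]ifact_pred //.
by rational_identity r s.
Qed.

Let cert_rE r s : cert_r r.+1 s = M r.+1 s * (q ^+ R.+1 / q ^+ r.+1)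
   * (a / t * q * q ^+ s ^+ 2 / q ^+ r.+1) * (1 - q ^+ R.+1 / q ^+ S)
   * (1 - q ^+ S.+1 / q ^+ s) * (1 - a * t * q ^+ r.+1).
Proof.
rewrite /cert_r /cert /M WS [ifact R S]ifact_pred // [ifact S s]ifact_pred //.
by rational_identity r s.
Qed.

Let cert_sE r s : (s <= R)%N ->
  cert_s r s = M r s * (q ^+ R * q ^+ r * t ^+ 2 * q / q ^+ s)
   * (1 - q ^+ R.+1 / q ^+ s) * (1 - q ^+ R.+1 / q ^+ S)
   * (1 - q ^+ R.+1 / q ^+ r) * (1 - q ^+ s).
Proof.
case: s => [|s] sR; first by rewrite expr0 subrr !mulr0.
rewrite /cert_s /cert /M -subSS qfactSB //.
rewrite [ifact R S]ifact_pred // [ifact s 0]ifact_pred // expr0 divr1.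
rewrite [ifact R r]ifact_pred //.
by rational_identity r s.
Qed.

Let cert_rsE r s : (s <= R)%N -> (r == 0%N -> s = 0%N) ->
  cert_rs r s = M r s * (q ^+ R.+1 / q ^+ r)
   * (1 - q ^+ R.+1 / q ^+ s) * (1 - q ^+ R.+1 / q ^+ S) * (1 - q ^+ s)
   * (1 - a * t * q ^+ r).
Proof.
case: s => [|s] sR rs.
  by rewrite expr0 subrr !(mulr0, mul0r); case: r {rs}.
case: r rs => [/(_ isT)//|r] _.
rewrite /cert_rs /cert_s /cert /M WS -subSS qfactSB //.
rewrite [ifact R S]ifact_pred // [ifact s 0]ifact_pred // expr0 divr1.
by rational_identity r s.
Qed.

Lemma cert_rgt r s : (R < r)%N -> cert r s = 0.
Proof. by move=> Rr; rewrite /cert [ifact R r]ifact_small ?(mulr0, mul0r). Qed.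

Lemma cert_sgt r s : (S < s)%N -> cert r s = 0.
Proof. by move=> Ss; rewrite /cert [ifact S s]ifact_small ?(mulr0, mul0r). Qed.

(* The only case in which R.+1 - s and R - s are not successive numbers. *)
Let tker_telescope_edge r s : (R < s)%N -> (s <= r)%N ->
  (t * (q ^+ R / q ^+ S) - a) * tker R.+1 S.+1 r s
  - t * (q ^+ R / q ^+ S) * (1 - q ^+ R.+1 / q ^+ S) * tker R.+1 S r s
  + a * (q ^+ R / q ^+ S) * tker R S r s + a * tker R S.+1 r s
  = (t * (q ^+ r / q ^+ s) - a) * cert_rs r s
  - t * (q ^+ r / q / q ^+ s) * ((1 - q ^+ r / q ^+ s) * cert_r r s)
  + a * (q ^+ r / q ^+ s) * cert r s + a * cert_s r s.
Proof.
case: s => // s; case: r => // r sR sr.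
have Ss : (S < s.+1)%N by rewrite ltnS (leq_trans SR).
rewrite /cert_rs /cert_r /cert_s !(cert_sgt _ Ss) !(@tker_sgt _ S) // !mulr0.
case: (ltnP R r) => [Rr|rR]; first by rewrite !cert_rgt ?tker_rgt ?mulr0 // ltnW.
have -> : r = R by apply/eqP; rewrite eqn_leq rR; exact: leq_trans sR sr.
have -> : s = R by apply/eqP; rewrite eqn_leq (leq_trans _ rR).
rewrite [cert R.+1 R]cert_rgt // !(mulr0, mul0r, addr0, subr0).
move: SR; rewrite leq_eqVlt => /predU1P[eS|SR']; last first.
  by rewrite cert_sgt // !(@tker_sgt _ S.+1) // !(mulr0, mul0r) addr0.
rewrite !eS (@tker_Sgt R) // mulr0 addr0 !divff ?expf_neq0 //; congr (_ * _).
rewrite /tker /cert eS !ifactSS !ifactnn !subnn !ifact0r qpoch0 !mulr1.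
have := qfact_neq0 qX_neq1 R; have := qfact_neq0 qX_neq1 R.+1.
have := W_neq0 R; have := W_neq0 R.+1.
move: (W R.+1) (P R.+1) (W R) (P R) => u v x y u0 x0 v0 y0.
have := expf_neq0 R q_neq0; move: (q ^+ R) (wt _ _) => z w z0.
by field; do ?[apply/andP; split].
Qed.

(** The left side is the coefficient of [h r s] in the relation for
[transfer h] at [(R, S)]; the right side is its coefficient in the combination
of the relations for [h] with the multipliers [cert].  The four terms
of the right side come from the four relations in which [h r s] occurs. *)
Lemma tker_telescope r s : (s <= r)%N ->
  (t * (q ^+ R / q ^+ S) - a) * tker R.+1 S.+1 r s
  - t * (q ^+ R / q ^+ S) * (1 - q ^+ R.+1 / q ^+ S) * tker R.+1 S r s
  + a * (q ^+ R / q ^+ S) * tker R S r s + a * tker R S.+1 r s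
  = (t * (q ^+ r / q ^+ s) - a) * cert_rs r s
  - t * (q ^+ r / q / q ^+ s) * ((1 - q ^+ r / q ^+ s) * cert_r r s)
  + a * (q ^+ r / q ^+ s) * cert r s + a * cert_s r s.
Proof.
move=> sr; case: (leqP s R) => sR; last exact: tker_telescope_edge.
have rs : r == 0%N -> s = 0%N by move/eqP=> r0; move: sr; rewrite r0; case: (s).
rewrite cert_rsE // cert_sE // certE //.
(* For r = 0 the closed form of cert_r fails, but its coefficient is 0. *)
have -> : (1 - q ^+ r / q ^+ s) * cert_r r s = (1 - q ^+ r / q ^+ s) * (M r s
   * (q ^+ R.+1 / q ^+ r)
   * (a / t * q * q ^+ s ^+ 2 / q ^+ r) * (1 - q ^+ R.+1 / q ^+ S)
   * (1 - q ^+ S.+1 / q ^+ s) * (1 - a * t * q ^+ r)).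
  case: (r) rs => [/(_ isT) ->|r' _]; last by rewrite cert_rE.
  by rewrite divff ?subrr ?mul0r ?expr0 ?oner_neq0.
rewrite /tker /M qfactSB // WS !qpochS ifactSS.
rewrite [ifact R S]ifact_pred // [ifact R S.+1]ifactS // [ifact R S]ifact_pred //.
rewrite [ifact S s]ifact_pred // [ifact R r]ifact_pred //.
by rational_identity r s.
Qed.

End Telescoping.

Lemma transfer_four_term h : four_term h -> four_term (transfer h).
Proof.
move=> [h0 hrel]; split=> [r s rs|R S SR].
  by apply: big1 => i _; apply: big1 => j _; rewrite tker_Sgt // mul0r.
apply/eqP; rewrite -subr_eq0; apply/eqP.
rewrite !(@transfer_box R.+1 h) //.
set n := R.+2; pose C := cert R S.
pose rel r s := (t * (q ^+ r / q ^+ s) - a) * h r.+1 s.+1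
  - t * (q ^+ r / q ^+ s) * (1 - q ^+ r.+1 / q ^+ s) * h r.+1 s
  + a * (q ^+ r / q ^+ s) * h r s + a * h r s.+1.
have rel0 r s : rel r s = 0.
  case: (leqP s r) => sr.
    apply/eqP; rewrite -(subr_eq0 (rel r s)).
    rewrite -(subrr (a * (h r.+1 s.+1 - q ^+ r / q ^+ s * h r s - h r s.+1))).
    by rewrite -{1}hrel // /rel; apply/eqP; ring.
  rewrite /rel !(h0 r.+1 s.+1, h0 r s, h0 r s.+1) ?ltnS ?(ltnW sr) //.
  move: sr; rewrite leq_eqVlt => /predU1P[<-|sr].
    by rewrite divff ?expf_neq0 // subrr !(mulr0, mul0r) !addr0 subr0.
  by rewrite (h0 r.+1 s) // !mulr0 !addr0 subr0.
transitivity (\sum_(r < n) \sum_(s < n)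
   ((t * (q ^+ r / q ^+ s) - a) * cert_rs R S r s
  - t * (q ^+ r / q / q ^+ s) * ((1 - q ^+ r / q ^+ s) * cert_r R S r s)
  + a * (q ^+ r / q ^+ s) * C r s + a * cert_s R S r s) * h r s).
  rewrite !mulrBr !mulr_sumr -!sumrB; apply: eq_bigr => r _.
  rewrite !mulr_sumr -!sumrB; apply: eq_bigr => s _.
  case: (leqP s r) => [sr|rs]; last by rewrite (h0 _ _ rs) !mulr0 !subr0.
  by rewrite -tker_telescope //; ring.
rewrite -[RHS](_ : \sum_(r < n) \sum_(s < n) C r s * rel r s = 0); last first.
  by apply: big1 => r _; apply: big1 => s _; rewrite rel0 mulr0.
rewrite [LHS](sum_ord_split4
  (f1 := fun r s => (t * (q ^+ r / q ^+ s) - a) * cert_rs R S r s * h r s)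
  (f2 := fun r s => - (t * (q ^+ r / q / q ^+ s)
                       * ((1 - q ^+ r / q ^+ s) * cert_r R S r s)) * h r s)
  (f3 := fun r s => a * (q ^+ r / q ^+ s) * C r s * h r s)
  (f4 := fun r s => a * cert_s R S r s * h r s)); last by move=> r s; ring.
rewrite [RHS](sum_ord_split4
  (f1 := fun r s => (t * (q ^+ r / q ^+ s) - a) * C r s * h r.+1 s.+1)
  (f2 := fun r s => - (t * (q ^+ r / q ^+ s)
                       * ((1 - q ^+ r.+1 / q ^+ s) * C r s)) * h r.+1 s)
  (f3 := fun r s => a * (q ^+ r / q ^+ s) * C r s * h r s)
  (f4 := fun r s => a * C r s * h r s.+1)); last by move=> r s; rewrite /rel; ring.
congr (_ + _ + _ + _).
- rewrite -(@sum_ord_shift F n (fun r =>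
    \sum_(s < n) (t * (q ^+ r / q ^+ s) - a) * cert_rs R S r s * h r s)).
  + apply: eq_bigr => r _.
    rewrite -(@sum_ord_shift F n (fun s =>
      (t * (q ^+ r.+1 / q ^+ s) - a) * cert_rs R S r.+1 s * h r.+1 s)).
    * by apply: eq_bigr => s _; rewrite !exprS invfM mulrACA divff // mul1r.
    * by rewrite /= mulr0 mul0r.
    * by rewrite /n /= cert_sgt ?ltnS // mulr0 mul0r.
  + by apply: big1 => s _; rewrite /= mulr0 mul0r.
  + by apply: big1 => -[[|s] ?] _; rewrite /n /= ?cert_rgt ?mulr0 ?mul0r.
- rewrite -(@sum_ord_shift F n (fun r => \sum_(s < n) - (t * (q ^+ r / q / q ^+ s)
    * ((1 - q ^+ r / q ^+ s) * cert_r R S r s)) * h r s)).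
  + apply: eq_bigr => r _; apply: eq_bigr => s _.
    by rewrite exprS [q * _ / q]mulrAC divff // mul1r.
  + by apply: big1 => s _; rewrite /= !mulr0 oppr0 mul0r.
  + by apply: big1 => s _; rewrite /n /= cert_rgt // !mulr0 oppr0 mul0r.
- apply: eq_bigr => r _.
  rewrite -(@sum_ord_shift F n (fun s => a * cert_s R S r s * h r s)) //.
  + by rewrite /= mulr0 mul0r.
  + by rewrite /n /= cert_sgt ?ltnS // mulr0 mul0r.
Qed.

(** * The diagonal of the transferred function *)

(** Up to normalization, the coefficient [g(R, n)] in the expansion described at
[four_term]: the [n]-th [q]-difference in [s] at [s = R]. *)
Definition qdiff (h : nat -> nat -> F) (R n : nat) : F :=
  \sum_(d < n.+1) gsign q d * h R (R - d)%N * ifact n d.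

Lemma qdiff0 h R : qdiff h R 0 = h R R.
Proof.
by rewrite /qdiff big_ord_recl big_ord0 addr0 gsign0 ifactnn subn0 mul1r mulr1.
Qed.

(** The relations in row [R + 1] between [S = R] and [S = R - j], added with the
weights of [qdiff].  This is the form [g(r, j) - t q^r g(r, j+1) = g(r-1, j)] of
the four-term relation. *)
Lemma qdiff_rec h R j : four_term h -> (j <= R)%N ->
  a * qdiff h R.+1 j - t * (1 - q ^+ j.+1) * qdiff h R.+1 j.+1
  = a * q ^+ j * qdiff h R j.
Proof.
move=> [h0 hrel] jR.
pose H d := h R.+1 (R.+1 - d)%N; pose K d := h R (R - d)%N.
(* The entry above the diagonal of row R is 0. *)
pose K' d := if d is d'.+1 then K d' else 0.
have rel d : (d <= j)%N ->
  t * q ^+ d * (H d - (1 - q ^+ d.+1) * H d.+1) = a * (H d - q ^+ d * K d - K' d).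
  move=> dj; have dR : (d <= R)%N by rewrite (leq_trans dj).
  have := hrel R (R - d)%N (leq_subr _ _).
  have -> : q ^+ R / q ^+ (R - d) = q ^+ d.
    by rewrite -{1}(subnK dR) exprD mulrAC divff ?mul1r // expf_neq0.
  have -> : q ^+ R.+1 / q ^+ (R - d) = q ^+ d.+1.
    by rewrite -{1}(subnK dR) -addnS exprD mulrAC divff ?mul1r // expf_neq0.
  rewrite -subSn // -/(H d) -/(K d) -[h R.+1 (R - d)%N]/(H d.+1) => ->.
  by congr (_ * (_ - _)); case: d {dj} dR => [|d'] dR //; rewrite subn0 h0.
have lhs : \sum_(d < j.+1) gsign q d * ifact j d
     * (t * q ^+ d * (H d - (1 - q ^+ d.+1) * H d.+1))
   = t * (1 - q ^+ j.+1) * qdiff h R.+1 j.+1.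
  transitivity (\sum_(d < j.+1) t * (gsign q d * q ^+ d * ifact j d * H d)
    + \sum_(d < j.+1)
        t * (gsign q d.+1 * (1 - q ^+ d.+1) * ifact j.+1 d.+1 * H d.+1)).
    by rewrite -big_split; apply: eq_bigr => d _; rewrite /= gsignS ifactSS; ring.
  rewrite (@sum_ord_extend F j.+1
    (fun d => t * (gsign q d * q ^+ d * ifact j d * H d))); last first.
    by rewrite (ifact_small _ (ltnSn j)) !(mulr0, mul0r).
  have -> : \sum_(d < j.+1)
       t * (gsign q d.+1 * (1 - q ^+ d.+1) * ifact j.+1 d.+1 * H d.+1)
     = \sum_(d < j.+2) t * (gsign q d * (1 - q ^+ d) * ifact j.+1 d * H d).
    by rewrite [RHS]big_ord_recl /= expr0 subrr !(mulr0, mul0r) add0r.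
  rewrite -big_split /qdiff mulr_sumr; apply: eq_bigr => d _ /=.
  rewrite -/(H d) ifact_pred //.
  by have := expf_neq0 d q_neq0; move: (q ^+ d) => x x0; field.
have rhs : \sum_(d < j.+1) gsign q d * ifact j d * (a * (H d - q ^+ d * K d - K' d))
   = a * qdiff h R.+1 j - a * q ^+ j * qdiff h R j.
  transitivity (a * qdiff h R.+1 j
     - \sum_(d < j.+1) a * gsign q d * ifact j d * q ^+ d * K d
     - \sum_(d < j.+1) a * gsign q d * ifact j d * K' d).
    by rewrite /qdiff mulr_sumr -!sumrB; apply: eq_bigr => d _; rewrite /= -/(H d); ring.
  have -> : \sum_(d < j.+1) a * gsign q d * ifact j d * K' d
     = \sum_(d < j.+1) a * gsign q d.+1 * ifact j d.+1 * K d.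
    rewrite big_ord_recl /= mulr0 add0r.
    apply: (@sum_ord_extend F j (fun d => a * gsign q d.+1 * ifact j d.+1 * K d)).
    by rewrite (ifact_small _ (ltnSn j)) !(mulr0, mul0r).
  rewrite -addrA -opprD -big_split /=; congr (_ - _); rewrite /qdiff mulr_sumr.
  apply: eq_bigr => d _; rewrite gsignS ifactS // -/(K d).
  by have := expf_neq0 d q_neq0; move: (q ^+ d) => x x0; field.
have e : \sum_(d < j.+1) gsign q d * ifact j d
     * (t * q ^+ d * (H d - (1 - q ^+ d.+1) * H d.+1))
  = \sum_(d < j.+1) gsign q d * ifact j d * (a * (H d - q ^+ d * K d - K' d)).
  by apply: eq_bigr => d _; rewrite rel // -ltnS.
by rewrite -lhs {}e rhs opprB addrC subrK.
Qed.

(** In the difference of order [R] the sum over [S] can be carried out for each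
[(r, s)]: it is an instance of [gsign_sum], which leaves [s = R], hence
[r = R]. *)
Lemma qdiff_transfer_top h R : four_term h ->
  qdiff (transfer h) R R = wt R R * ifact R 0 * h R R.
Proof.
move=> [h0 _].
have inner r s : (s < R.+1)%N ->
  \sum_(d < R.+1) gsign q d * ifact R d * tker R (R - d) r s
   = W R / W r * P (R - s) * wt r s * ifact R r * ifact s 0 * (s == R)%:R.
  rewrite ltnS => sR.
  have -> : (s == R) = (R - s == 0)%N by rewrite subn_eq0 eqn_leq sR.
  rewrite -(gsign_sum q_neq0 qX_neq1 (leq_subr s R)) mulr_sumr.
  apply: eq_bigr => d _; have dR : (d <= R)%N by rewrite -ltnS.
  rewrite /tker.
  have -> : ifact R (R - d) = ifact d 0.
    by rewrite ifactE ?leq_subr // subKn // ifact0r.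
  have -> : ifact (R - d) s = ifact (R - s) d.
    case: (leqP (s + d) R) => sdR; last by rewrite !ifact_small // ltn_subLR // addnC.
    have sd : (s <= R - d)%N by rewrite leq_subRL // addnC.
    have ds : (d <= R - s)%N by rewrite leq_subRL.
    by rewrite !ifactE // subnAC.
  rewrite (ifactE q dR); have := qfact_neq0 qX_neq1 (R - d); have := W_neq0 r.
  by move: (W r) (P (R - d)) => x y x0 y0; field; rewrite x0 y0.
transitivity (\sum_(r < R.+1) \sum_(s < R.+1)
    (\sum_(d < R.+1) gsign q d * ifact R d * tker R (R - d) r s) * h r s).
  rewrite /qdiff /transfer.
  under eq_bigr => d _.
    rewrite mulrAC mulr_sumr; under eq_bigr => r _ do rewrite mulr_sumr.
    over.
  rewrite exchange_big; apply: eq_bigr => r _.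
  rewrite exchange_big; apply: eq_bigr => s _.
  by rewrite mulr_suml; apply: eq_bigr => d _; rewrite mulrA.
rewrite big_ord_recr big1 /= ?add0r => [|r _]; last first.
  apply: big1 => s _; rewrite inner //.
  case: eqP => [->|_]; last by rewrite mulr0 mul0r.
  by rewrite h0 ?mulr0.
rewrite big_ord_recr big1 /= ?add0r => [|s _]; last first.
  by rewrite (inner _ _ (leqW (ltn_ord s))) (ltn_eqF (ltn_ord s)) mulr0 mul0r.
by rewrite inner // eqxx subnn qpoch0 ifactnn divff ?qpoch_neq0 // !mulr1 mul1r.
Qed.

(** By [qdiff_rec] the differences of order [j] are determined by those of order
[j + 1] in the same row and of order [j] in the previous row, hence by those of
top order; the right side satisfies the same recursion and has the same values
in top order. *)
Lemma qdiff_transfer B h R j : four_term h -> (R <= B)%N -> (j <= R)%N ->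
  qdiff (transfer h) R j = (a / t) ^+ j * q ^+ (R * j) * ifact j 0 * P (R - j)
    * \sum_(r < B.+1) t ^+ (2 * r) * q ^+ (r * r) / q ^+ (j * r) * ifact r j
                        * ifact R r * h r r.
Proof.
move=> ha; have sha := transfer_four_term ha.
pose D R j := (a / t) ^+ j * q ^+ (R * j) * ifact j 0 * P (R - j)
    * \sum_(r < B.+1) t ^+ (2 * r) * q ^+ (r * r) / q ^+ (j * r) * ifact r j
                        * ifact R r * h r r.
rewrite -/(D R j).
have top n : (n <= B)%N -> qdiff (transfer h) n n = D n n.
  move=> nB; rewrite qdiff_transfer_top // /D subnn qpoch0.
  rewrite (bigD1 (Ordinal (nB : n < B.+1)%N)) //= big1 => [|r /eqP rn]; last first.
    have : nat_of_ord r != n by apply/eqP => e; apply: rn; apply: val_inj.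
    rewrite neq_ltn => /orP[rn'|rn'].
      by rewrite [ifact r n]ifact_small // !(mulr0, mul0r).
    by rewrite [ifact n r]ifact_small // !(mulr0, mul0r).
  rewrite !ifactnn /wt; have := expf_neq0 (n * n) q_neq0.
  by move: (q ^+ (n * n)) => x x0; field; rewrite ?x0 ?t_neq0.
have Drec n i : (i <= n)%N ->
  a * D n.+1 i - t * (1 - q ^+ i.+1) * D n.+1 i.+1 = a * q ^+ i * D n i.
  move=> ijn; rewrite /D !mulr_sumr -sumrB; apply: eq_bigr => r _.
  rewrite subSS subSn // qpochS -exprS [ifact i 0]ifact_pred //.
  rewrite [ifact n r]ifact_pred // [ifact r i.+1]ifactS //.
  have -> : q ^+ (n - i).+1 = q ^+ n.+1 / q ^+ i by rewrite -subSn // expfB.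
  rewrite !mulSn !mulnS !exprD !exprS expr0 divr1.
  have := expf_neq0 i q_neq0; have := expf_neq0 r q_neq0.
  have := expf_neq0 (i * r) q_neq0.
  move: (q ^+ (i * r)) (q ^+ i) (q ^+ r) (q ^+ n) (q ^+ (r * r)) (q ^+ (n * i))
    (t ^+ (2 * r)) ((a / t) ^+ i) (P _) (ifact _ _) (ifact _ _) (ifact _ _)
    => x y z u v w T A' p1 i1 i2 i3 x0 z0 y0.
  by field; rewrite ?x0 ?y0 ?z0 ?t_neq0.
elim: R j => [|R IH] j RB; first by rewrite leqn0 => /eqP ->; exact: top.
move=> jR; rewrite -(subKn jR); have : (R.+1 - j <= R.+1)%N by exact: leq_subr.
elim: (R.+1 - j)%N => [|k IHk] kR; first by rewrite subn0 top.
have kR' : (R.+1 - k.+1 <= R)%N by rewrite subSS leq_subr.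
have := qdiff_rec sha kR'; have := Drec R _ kR'.
have -> : (R.+1 - k.+1).+1 = (R.+1 - k)%N by rewrite -subSn.
rewrite IHk ?(ltnW kR) // IH ?(ltnW RB) // => <- /eqP; rewrite subr_eq subrK => /eqP.
by move/(mulfI a_neq0).
Qed.

(** The Bailey-type iteration that produces the [m]-fold sum, acting on the
diagonal of [h]. *)
Lemma transfer_diag h N : four_term h ->
  transfer h N N * ifact N 0
  = \sum_(r < N.+1) t ^+ (2 * r) * q ^+ (r * r) * ifact N r * (h r r * ifact r 0).
Proof.
move=> ha; rewrite -qdiff0 (qdiff_transfer (B := N)) //.
rewrite subn0 muln0 !expr0 ifactnn !mul1r mulrAC ifact0r mulfV ?qfact_neq0 //.
by rewrite mul1r; apply: eq_bigr => r _; rewrite divr1; ring.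
Qed.

End Transfer.

(** * Sums over chains *)

Section ChainSum.
Variables (F : fieldType) (T : Type) (e : T -> F) (k : T -> T -> F).

Fixpoint chain (x : T) (l : seq T) : F :=
  if l is y :: l' then k x y * chain y l' else e x.

Lemma chainE x0 x l :
  chain x l = (\prod_(0 <= i < size l) k (nth x0 (x :: l) i) (nth x0 (x :: l) i.+1))
              * e (nth x0 (x :: l) (size l)).
Proof.
elim: l x => [|y l IH] x /=; first by rewrite big_geq ?mul1r.
by rewrite IH big_nat_recl //= mulrA.
Qed.

Lemma big_tuple_cons (I : finType) n (f : n.+1.-tuple I -> F) :
  \sum_(z : n.+1.-tuple I) f z
  = \sum_(x : I) \sum_(l : n.-tuple I) f (cons_tuple x l).
Proof.
rewrite pair_bigA /= (reindex (fun p : I * n.-tuple I => cons_tuple p.1 p.2)) //.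
exists (fun z : n.+1.-tuple I => (thead z, behead_tuple z)) => [[x l] _|z _].
  by rewrite theadE; congr (_, _); apply: val_inj.
by case/tupleP: z => x l; apply: val_inj; rewrite /= theadE.
Qed.

(** The entries are indexed by a finite type [I] through [v], so that the weights
can be functions of natural numbers that do not know the summation bound. *)
Definition chain_sum (I : finType) (v : I -> T) n (phi : T -> F) : F :=
  \sum_(x : I) \sum_(l : n.-tuple I) phi (v x) * chain (v x) (map v l).

Lemma chain_sum0 (I : finType) (v : I -> T) phi :
  chain_sum v 0 phi = \sum_(x : I) phi (v x) * e (v x).
Proof.
apply: eq_bigr => x _; rewrite (big_pred1 [tuple]) //= => l.
by rewrite (tuple0 l) /= eqxx.
Qed.

(** Summing over the first entry replaces the function [phi] of the first entry by
its image under the operator with kernel [k]. *)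
Lemma chain_sumS (I : finType) (v : I -> T) n phi :
  chain_sum v n.+1 phi
  = chain_sum v n (fun y => \sum_(x : I) phi (v x) * k (v x) y).
Proof.
rewrite /chain_sum; under eq_bigr do rewrite big_tuple_cons /=.
rewrite exchange_big; apply: eq_bigr => y _.
rewrite exchange_big; apply: eq_bigr => l _ /=.
by rewrite mulr_suml; apply: eq_bigr => x _; rewrite mulrA.
Qed.

Lemma eq_chain_sum (I : finType) (v : I -> T) n phi psi :
  (forall x, phi (v x) = psi (v x)) -> chain_sum v n phi = chain_sum v n psi.
Proof.
by move=> E; apply: eq_bigr => x _; apply: eq_bigr => l _; rewrite E.
Qed.

End ChainSum.

Lemma fsum_codom (F : fieldType) (J : finType) (T : choiceType)
    (enc : J -> T) (G : T -> F) :
  injective enc -> (forall x, x \notin codom enc -> G x = 0) ->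
  \sum_(x \in [set: T]) G x = \sum_(j : J) G (enc j).
Proof.
move=> inj G0; rewrite (fsbigE (codom enc)) //.
- by rewrite big_map big_enum_cond; apply: eq_bigl => j; rewrite in_setT.
- by rewrite map_inj_uniq ?enum_uniq.
- by move=> x _; exact: G0.
Qed.

Definition ord_val N (x : 'I_N.+1) : nat := x.

Lemma Ysum_box (F : fieldType) (q t : F) m N :
  Ysum m N t q = \sum_(z : m.-tuple 'I_N.+1) Yterm m N t q (map (@ord_val N) z).
Proof.
pose enc (z : m.-tuple 'I_N.+1) := map_tuple (@ord_val N) z.
have encI : injective enc.
  move=> z z' e1; apply: eq_from_tnth => i; apply: val_inj.
  by have := congr1 (fun u : m.-tuple nat => tnth u i) e1; rewrite !tnth_map.
rewrite /Ysum (@fsum_codom _ _ _ enc (fun n => Yterm m N t q n)) //.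
move=> n /codomP rs; apply/eqP; apply: contra_notT rs => /Yterm_support supp.
have le i : (tnth n i <= N)%N.
  by have := supp i.+1; rewrite /ix /= -!tnth_nth !lez_nat; apply; exact: ltn_ord.
exists [tuple inord (tnth n i) | i < m].
by apply: eq_from_tnth => i; rewrite tnth_map tnth_mktuple /ord_val inordK // ltnS.
Qed.

(** * The two multisums as chain sums *)

Section Terms.
Variables (F : fieldType) (q a t : F).
Hypothesis q_neq0 : q != 0.
Hypothesis qX_neq1 : forall n : nat, 1 - q ^+ n.+1 != 0.
Hypothesis a_neq0 : a != 0.
Hypothesis t_neq0 : t != 0.
Hypothesis atqX_neq1 : forall n : nat, 1 - a * t * q * q ^+ n != 0.
Hypothesis aqX_neq1 : forall n : nat, 1 - a * q * q ^+ n != 0.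
Hypothesis tqX_neq1 : forall n : nat, 1 - t * q * q ^+ n != 0.

Local Notation P := (qpoch q q).
Local Notation W := (qpoch (a * t * q) q).
Local Notation ifact := (ifact q).
Local Notation wt := (wt q a t).
Local Notation transfer := (transfer q a t).

Definition seed (r s : nat) : F :=
  qpoch (a * q) q r * ifact r s / (qpoch (a * q) q s * qpoch (t * q) q r).

(** The quotients of neighbouring values are rational functions of [q^r] and
[q^s], so that only an identity of rational functions remains. *)
Lemma seed_four_term : four_term q a t seed.
Proof.
split=> [r s rs|r s sr]; first by rewrite /seed ifact_small // !(mulr0, mul0r).
rewrite /seed ifactSS ifactS // [ifact r s]ifact_pred // !qpochS !exprS.
have := qpoch_neq0 s aqX_neq1; have := aqX_neq1 s.
have := qpoch_neq0 r tqX_neq1; have := tqX_neq1 r.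
have := expf_neq0 s q_neq0.
move: (qpoch _ _ _) (qpoch _ _ _) (qpoch _ _ _) (ifact _ _) (q ^+ r) (q ^+ s)
  => x y z i u v.
move=> v0 t1 z0 a1 y0; field.
by do ?[apply/andP; split]; rewrite ?mulrA.
Qed.

(** In the multisum the upper index [R - s] need not be at least [R - S], nor need
either of them be nonnegative: in these cases one of the last two factors is
0. *)
Lemma qbinomE (R S s : nat) :
  qbinom q (R%:Z - s%:Z) (R%:Z - S%:Z) = P (R - s) * ifact R S * ifact S s.
Proof.
rewrite /qbinom; case: (leqP S R) => SR; last first.
  by rewrite ifact_small // mulr0 mul0r subr_ge0 lez_nat leqNgt SR.
case: (leqP s S) => sS; last first.
  rewrite [ifact S s]ifact_small // mulr0 lerD2l lerN2 lez_nat leqNgt sS.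
  by rewrite andbF.
rewrite subr_ge0 lerD2l lerN2 !lez_nat SR sS /=.
have -> : R%:Z - s%:Z - (R%:Z - S%:Z) = S%:Z - s%:Z by ring.
by rewrite !subzn ?(leq_trans sS) //= !ifactE // invfM mulrA.
Qed.

(** [linkX] and [linkY] hold the factors of a summand that depend on an entry and
its predecessor, [headX] and [headY] those of the first entry; in the latter the
factor special to the first entry is replaced by an arbitrary function, to make
room for the induction on the number of entries. *)
Definition linkX (x y : nat * nat) : F :=
  ifact y.1 x.1 * qbinom q (y.1%:Z - x.2%:Z) (y.1%:Z - y.2%:Z) * wt y.1 y.2.

Definition headX (h : nat -> nat -> F) (x : nat * nat) : F :=
  wt x.1 x.2 * h x.1 x.2 * ifact x.2 0 / W x.1.

Definition linkY (x y : nat) : F := ifact y x * (t ^+ (2 * y) * q ^+ (y * y)).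

Definition headY (h : nat -> nat -> F) (x : nat) : F :=
  t ^+ (2 * x) * q ^+ (x * x) * (h x x * ifact x 0).

Definition pair_val N (x : 'I_N.+1 * 'I_N.+1) : nat * nat := (val x.1, val x.2).

(** The last sum of the chain, which has no pair to its right, is the value of
[transfer] at [S = R = N]: there the two factors [(q)_(N-s)] of the kernel
cancel.  This is how a sum over pairs becomes a value on the diagonal. *)
Lemma chain_sumX N h n :
  W N * chain_sum (fun x => ifact N x.1) linkX (@pair_val N) n (headX h)
  = iter n.+1 transfer h N N * ifact N 0.
Proof.
have W0 r : W r != 0 by exact: qpoch_neq0.
elim: n h => [|n IH] h.
  rewrite chain_sum0 /= (@transfer_box _ _ _ _ N) // pair_bigA mulr_sumr mulr_suml.
  apply: eq_bigr => -[r s] _; rewrite /headX /pair_val /tker /= ifactnn.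
  have sN : (s <= N)%N by rewrite -ltnS.
  rewrite (ifactE q sN) !ifact0r.
  have := qfact_neq0 qX_neq1 N; have := qfact_neq0 qX_neq1 (N - s); have := W0 r.
  move: (P N) (P (N - s)) (W r) => x y z z0 y0 x0.
  by field; rewrite ?x0 ?y0 ?z0 ?qfact_neq0.
rewrite chain_sumS iterSr -IH; congr (_ * _).
apply: eq_chain_sum => -[y1 y2]; rewrite /headX /linkX /pair_val /=.
have y1N : (y1 <= N)%N by rewrite -ltnS.
rewrite (@transfer_box _ _ _ _ N) // pair_bigA mulr_sumr !mulr_suml /=.
apply: eq_bigr => -[r s] _; rewrite qbinomE /tker /= [ifact y2 0]ifact0r.
have := qfact_neq0 qX_neq1 y2; have := W0 y1; have := W0 r.
move: (P y2) (W y1) (W r) => x y z z0 y0 x0.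
by field; rewrite ?x0 ?y0 ?z0 ?qfact_neq0.
Qed.

Lemma chain_sumY N h n : four_term q a t h ->
  chain_sum (ifact N) linkY (@ord_val N) n (headY h)
  = iter n.+1 transfer h N N * ifact N 0.
Proof.
elim: n h => [|n IH] h ha.
  rewrite chain_sum0 /= transfer_diag //; apply: eq_bigr => r _.
  by rewrite /headY /ord_val; ring.
rewrite chain_sumS iterSr -IH; last exact: transfer_four_term.
apply: eq_chain_sum => y; rewrite /headY /linkY /ord_val transfer_diag //.
rewrite (@sum_ord_widen F y.+1 N.+1
  (fun r => t ^+ (2 * r) * q ^+ (r * r) * ifact y r * (h r r * ifact r 0))) //.
  by rewrite mulr_sumr; apply: eq_bigr => r _; ring.
by move=> r yr; rewrite [ifact y r]ifact_small // mulr0 mul0r.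
Qed.

Lemma prodr_expz (x : F) (I : Type) (r : seq I) (f : I -> int) : x != 0 ->
  x ^ (\sum_(i <- r) f i) = \prod_(i <- r) x ^ f i.
Proof.
by move=> x0; apply: (big_morph (exprz x)) => [m n|]; rewrite ?expfzDr ?expr0z.
Qed.

Lemma wtE (r s : nat) :
  a ^ s%:Z * t ^ (2 * r%:Z - s%:Z) * q ^ (r%:Z ^+ 2 - r%:Z * s%:Z + s%:Z ^+ 2)
  = wt r s.
Proof.
by rewrite !expr2 -!PoszM !expfzDr // -!invr_expz -!exprnP /wt expr_div_n; ring.
Qed.

Lemma nth_map_default (T1 T2 : Type) (f : T1 -> T2) x s i :
  nth (f x) (map f s) i = f (nth x s i).
Proof. by elim: s i => [|y s IH] [|i] /=. Qed.

Lemma Xterm_chain N p l :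
  Xterm (size l).+1 N a t q (map fst (p :: l)) (map snd (p :: l))
  = headX seed p * chain (fun x => ifact N x.1) linkX p l.
Proof.
pose x0 : nat * nat := (0, 0)%N; set L := p :: l.
have ix1 i : ix (map fst L) i.+1 = (nth x0 L i).1%:Z.
  by rewrite /ix /= -(nth_map_default fst x0 L).
have ix2 i : ix (map snd L) i.+1 = (nth x0 L i).2%:Z.
  by rewrite /ix /= -(nth_map_default snd x0 L).
have wts : a ^ (\sum_(1 <= i < (size l).+2) ix (map snd L) i)
   * t ^ (\sum_(1 <= i < (size l).+2) (2 * ix (map fst L) i - ix (map snd L) i))
   * q ^ (\sum_(1 <= i < (size l).+2) (ix (map fst L) i ^+ 2
            - ix (map fst L) i * ix (map snd L) i + ix (map snd L) i ^+ 2))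
   = \prod_(0 <= i < (size l).+1) wt (nth x0 L i).1 (nth x0 L i).2.
  rewrite !big_add1 !prodr_expz // -!big_split /=.
  by apply: eq_bigr => i _; rewrite ix1 ix2 wtE.
have facts : \prod_(1 <= i < (size l).+2)
     inv_qfact q (ix (map fst L) i - ix (map fst L) i.-1)
   = ifact p.1 0 * \prod_(0 <= i < size l) ifact (nth x0 L i.+1).1 (nth x0 L i).1.
  rewrite big_add1 big_nat_recl //; congr (_ * _).
  by apply: eq_bigr => i _; rewrite !ix1.
have binoms : \prod_(1 <= i < (size l).+2)
     qbinom q (ix (map fst L) i - ix (map snd L) i.-1)
              (ix (map fst L) i - ix (map snd L) i)
   = P p.1 * ifact p.1 p.2 * ifact p.2 0 * \prod_(0 <= i < size l)
       qbinom q ((nth x0 L i.+1).1%:Z - (nth x0 L i).2%:Z)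
                ((nth x0 L i.+1).1%:Z - (nth x0 L i.+1).2%:Z).
  rewrite big_add1 big_nat_recl //; congr (_ * _).
    have -> : ix (map snd L) 1.-1 = Posz 0 by [].
    by rewrite !ix1 !ix2 qbinomE subn0.
  by apply: eq_bigr => i _; rewrite /= !ix1 !ix2.
rewrite /Xterm {}wts /inv_qchain {}facts {}binoms !ix1 !ix2 !absz_nat.
rewrite big_nat_recl // /headX (chainE _ _ x0) -/L /seed.
have -> : \prod_(0 <= i < size l) linkX (nth x0 L i) (nth x0 L i.+1)
  = \prod_(0 <= i < size l) ifact (nth x0 L i.+1).1 (nth x0 L i).1
    * \prod_(0 <= i < size l) qbinom q ((nth x0 L i.+1).1%:Z - (nth x0 L i).2%:Z)
                                ((nth x0 L i.+1).1%:Z - (nth x0 L i.+1).2%:Z)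
    * \prod_(0 <= i < size l) wt (nth x0 L i.+1).1 (nth x0 L i.+1).2.
  by rewrite -!big_split.
rewrite -[inv_qfact q (N%:Z - _)]/(ifact N _) /= [ifact p.1 0]ifact0r.
have := qfact_neq0 qX_neq1 p.1; have := qpoch_neq0 p.1 atqX_neq1.
have := qpoch_neq0 p.2 aqX_neq1; have := qpoch_neq0 p.1 tqX_neq1.
move: (qpoch (t * q) q p.1) (qpoch (a * q) q p.2) (W p.1) (P p.1) => x y z u.
move=> x_neq0 y_neq0 z_neq0 u_neq0; field.
by rewrite x_neq0 y_neq0 z_neq0 u_neq0.
Qed.

Lemma Yterm_chain N n l :
  Yterm (size l).+1 N t q (n :: l) = headY seed n * chain (ifact N) linkY n l.
Proof.
set L := n :: l; have ixL i : ix L i.+1 = (nth 0%N L i)%:Z by [].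
have wts : t ^ (\sum_(1 <= i < (size l).+2) 2 * ix L i)
    * q ^ (\sum_(1 <= i < (size l).+2) ix L i ^+ 2)
    = \prod_(0 <= i < (size l).+1)
        (t ^+ (2 * nth 0%N L i) * q ^+ (nth 0%N L i * nth 0%N L i)).
  rewrite !big_add1 !prodr_expz // -!big_split /=.
  by apply: eq_bigr => i _; rewrite ixL expr2 -!PoszM.
have facts : \prod_(1 <= i < (size l).+2) inv_qfact q (ix L i - ix L i.-1)
   = ifact n 0 * \prod_(0 <= i < size l) ifact (nth 0%N L i.+1) (nth 0%N L i).
  by rewrite big_add1 big_nat_recl.
rewrite /Yterm {}wts /inv_qchain {}facts !ixL !absz_nat.
rewrite big_nat_recl // /headY (chainE _ _ 0%N) -/L /seed ifactnn.
have -> : \prod_(0 <= i < size l) linkY (nth 0%N L i) (nth 0%N L i.+1)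
  = \prod_(0 <= i < size l) ifact (nth 0%N L i.+1) (nth 0%N L i)
    * \prod_(0 <= i < size l)
        (t ^+ (2 * nth 0%N L i.+1) * q ^+ (nth 0%N L i.+1 * nth 0%N L i.+1)).
  by rewrite -big_split.
rewrite -[inv_qfact q (N%:Z - _)]/(ifact N _) /=.
have := qpoch_neq0 n aqX_neq1; have := qpoch_neq0 n tqX_neq1.
move: (qpoch (t * q) q n) (qpoch (a * q) q n) => x y x_neq0 y_neq0; field.
by rewrite x_neq0 y_neq0.
Qed.

Lemma pair_val_inj N : injective (@pair_val N).
Proof. by move=> [r s] [r' s'] [/val_inj -> /val_inj ->]. Qed.

Lemma XsumE m N : Xsum m.+1 N a t q = iter m.+1 transfer seed N N * ifact N 0.
Proof.
pose enc (z : m.+1.-tuple ('I_N.+1 * 'I_N.+1)) :=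
  (map_tuple (fun x => (pair_val x).1) z, map_tuple (fun x => (pair_val x).2) z).
have encI : injective enc.
  move=> z z' [e1 e2]; apply: eq_from_tnth => i; apply: pair_val_inj.
  have := congr1 (fun u => nth 0%N u i) e1.
  have := congr1 (fun u => nth 0%N u i) e2.
  rewrite !(nth_map (tnth z i)) ?size_tuple // -!tnth_nth => h2 h1.
  by rewrite /pair_val; congr (_, _).
rewrite /Xsum.
rewrite (@fsum_codom _ _ _ enc (fun rs => Xterm m.+1 N a t q rs.1 rs.2)) //; last first.
  move=> [r s] /codomP rs; apply/eqP.
  apply: contra_notT rs => /Xterm_support /= supp.
  have le i : (tnth s i <= tnth r i)%N && (tnth r i <= N)%N.
    have := supp i.+1; rewrite /ix /= -!tnth_nth !lez_nat; apply; exact: ltn_ord.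
  exists [tuple (inord (tnth r i), inord (tnth s i)) | i < m.+1].
  congr (_, _); apply: eq_from_tnth => i;
    rewrite tnth_map tnth_mktuple /pair_val /= inordK //.
    by have /andP[] := le i; rewrite ltnS.
  by have /andP[] := le i; rewrite ltnS; exact: leq_trans.
rewrite -chain_sumX; congr (_ * _).
rewrite big_tuple_cons; apply: eq_bigr => x _; apply: eq_bigr => l _.
rewrite -Xterm_chain size_map size_tuple.
by congr (Xterm _ _ _ _ _ _ _); rewrite /= -map_comp.
Qed.

Lemma YsumE m N : Ysum m.+1 N t q = iter m.+1 transfer seed N N * ifact N 0.
Proof.
rewrite Ysum_box -chain_sumY; last exact: seed_four_term.
rewrite big_tuple_cons; apply: eq_bigr => x _; apply: eq_bigr => l _.
by rewrite -Yterm_chain size_map size_tuple.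
Qed.

Lemma Xsum_eq_Ysum m N : Xsum m.+1 N a t q = Ysum m.+1 N t q.
Proof. by rewrite XsumE YsumE. Qed.

End Terms.

(** * Rational functions *)

Section Morphism.
Variables (F K : fieldType) (f : {rmorphism F -> K}).

Lemma qpoch_rmorph A q n : f (qpoch A q n) = qpoch (f A) (f q) n.
Proof.
rewrite rmorph_prod; apply: eq_bigr => i _.
by rewrite rmorphB rmorph1 rmorphM rmorphXn.
Qed.

Lemma inv_qfact_rmorph q k : f (inv_qfact q k) = inv_qfact (f q) k.
Proof. by case: k => k; rewrite ?rmorph0 // fmorphV qpoch_rmorph. Qed.

(** For [f := rconst_morph] this says that the right side of the theorem, which is
computed from [t] and [q] alone, is a constant for [a]. *)
Lemma Ysum_rmorph m N t q : f (Ysum m N t q) = Ysum m N (f t) (f q).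
Proof.
rewrite !Ysum_box rmorph_sum; apply: eq_bigr => z _.
rewrite /Yterm /inv_qchain !rmorphM !fmorphXz fmorphV qpoch_rmorph rmorphM.
rewrite rmorph_prod inv_qfact_rmorph.
by under eq_bigr do rewrite inv_qfact_rmorph.
Qed.

End Morphism.

Definition rconst_morph (F : fieldType) : {rmorphism F -> ratfun F} :=
  @FracField.tofrac {poly F} \o @polyC F.

Lemma rconstE (F : fieldType) (c : F) : rconst c = rconst_morph F c.
Proof. by []. Qed.

Lemma rconst_eq0 (F : fieldType) (c : F) : (rconst c == 0) = (c == 0).
Proof. by rewrite rconstE fmorph_eq0. Qed.

Lemma rconst1 (F : fieldType) : rconst (1 : F) = 1.
Proof. exact: (rmorph1 (rconst_morph F)). Qed.

Lemma rconstB (F : fieldType) : {morph @rconst F : x y / x - y}.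
Proof. exact: (rmorphB (rconst_morph F)). Qed.

Lemma rconstM (F : fieldType) : {morph @rconst F : x y / x * y}.
Proof. exact: (rmorphM (rconst_morph F)). Qed.

Lemma rconstX (F : fieldType) n : {morph @rconst F : x / x ^+ n}.
Proof. exact: (rmorphXn (rconst_morph F)). Qed.

Lemma rvar_neq0 (F : fieldType) : rvar F != 0.
Proof. by rewrite tofrac_eq0 polyX_eq0. Qed.

(** The element is a polynomial with constant term 1. *)
Lemma one_sub_rvar_neq0 (F : fieldType) (c : F) n :
  1 - rvar F ^+ n.+1 * rconst c != 0.
Proof.
rewrite /rvar /rconst -(rmorph1 (@FracField.tofrac {poly F})).
rewrite -rmorphXn -rmorphM -rmorphB tofrac_eq0.
apply: contraTneq (oner_neq0 F) => /(congr1 (horner^~ 0)).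
by rewrite !hornerE exprS mul0r mul0r subr0 => ->; rewrite eqxx.
Qed.

Theorem theorem1p3 (k : fieldType) (m : nat) (hm : (1 <= m)%N) (N : nat) :
  independent_of_a (Xsum m N (var_a k) (var_t k) (var_q k))
  /\ Xsum m N (var_a k) (var_t k) (var_q k) = Ysum m N (var_t k) (var_q k).
Proof.
case: m hm => // m _.
set q1 := rvar k; set q2 := rconst q1; set t2 := rvar (ratfun k).
have XY : Xsum m.+1 N (var_a k) (var_t k) (var_q k) = Ysum m.+1 N (var_t k) (var_q k).
  have a_gen (c : ratfun_tq k) : 1 - var_a k * rconst c != 0.
    by have := one_sub_rvar_neq0 c 0; rewrite expr1.
  have t_gen (c : ratfun k) : 1 - t2 * rconst c != 0.
    by have := one_sub_rvar_neq0 c 0; rewrite expr1.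
  apply: Xsum_eq_Ysum.
  - by rewrite !rconst_eq0 rvar_neq0.
  - move=> n; rewrite -!rconstX -!rconst1 -!rconstB !rconst_eq0.
    by have := one_sub_rvar_neq0 (1 : k) n; rewrite rconst1 mulr1.
  - exact: rvar_neq0.
  - by rewrite rconst_eq0 rvar_neq0.
  - by move=> n; have := a_gen (t2 * q2 * q2 ^+ n); rewrite !rconstM rconstX !mulrA.
  - by move=> n; have := a_gen (q2 * q2 ^+ n); rewrite rconstM rconstX mulrA.
  - move=> n; have := t_gen (q1 * q1 ^+ n).
    by rewrite -rconst_eq0 rconstB rconst1 !rconstM !rconstX mulrA.
split=> //; exists (Ysum m.+1 N t2 q2).
by rewrite XY rconstE Ysum_rmorph.
Qed.
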